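(* For $\delta>-1$, let $\mu$ be the law of the friendship bias $\Delta_\phi$ of the root of the Pólya point tree with parameters $m=1$ and $\delta$ (the local limit of the preferential attachment model with one edge per new vertex and shift parameter $\delta$). Then $\mu([0,\infty))>\frac12$ for every $\delta>-1$. In addition, $\lim_{\delta\downarrow-1}\mu([0,\infty))=1$.
   Context: Pólya point tree ($m=1$, $\delta>-1$): a multi-type branching process tree with root $\phi$ in which each vertex $u$ has an age $A_u\in[0,1]$, and each non-root vertex also has a label $L_u\in\{\mathsf y,\mathsf o\}$ (''younger'' or ''older'' than its parent). The root's age $A_\phi$ is uniform on $[0,1]$ and the root has no label. Recursively, given a vertex $u$ with its age (and label): (1) If $u=\phi$ or $L_u=\mathsf o$, then $u$ has exactly one child with label $\mathsf o$, denoted $u1$, with age $A_{u1}=U_{u1}^{(2+\delta)/(1+\delta)}A_u$, where $U_{u1}$ is uniform on $[0,1]$, independent of everything else. If $L_u=\mathsf y$, then $u$ has no child with label $\mathsf o$. (2) The ages of the children of $u$ with label $\mathsf y$ are the (ordered) points of a Poisson point process on $[A_u,1]$ with intensity $\rho_u(x)=\frac{\Gamma_u}{2+\delta}\,\frac{x^{-(1+\delta)/(2+\delta)}}{A_u^{1/(2+\delta)}}$, where $\Gamma_u$ is chosen independently of everything else, with $\Gamma_u\sim\mathrm{Gamma}(1+\delta,1)$ if $u$ is the root or $L_u=\mathsf y$, and $\Gamma_u\sim\mathrm{Gamma}(2+\delta,1)$ if $L_u=\mathsf o$. These children are enumerated after the $\mathsf o$-child (if any). Let $d_\phi\ge1$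 be the number of children of the root, and $d_j$ the number of children of the $j$-th child $\phi_j$ of the root ($\phi_1$ is the $\mathsf o$-child, $\phi_2,\ldots,\phi_{d_\phi}$ the $\mathsf y$-children). The friendship bias of the root is $\Delta_\phi=\frac1{d_\phi}\sum_{j=1}^{d_\phi}(d_j+1)-d_\phi$, and $\mu$ (depending on $\delta$) is its law. *)

(* Defs.v *)
From HB Require Import structures.
From mathcomp Require Import all_boot all_order all_algebra.
From mathcomp Require Import all_classical all_reals all_analysis.
From mathcomp Require Import measurable_realfun.

Set Implicit Arguments.
Unset Strict Implicit.
Unset Printing Implicit Defensive.

Import Order.TTheory GRing.Theory Num.Theory.
Import numFieldNormedType.Exports.

Local Open Scope classical_set_scope.
Local Open Scope ring_scope.

Section gamma_distribution.
Context {R : realType}.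
Implicit Types alpha x : R.

Definition Gamma_fun alpha : R :=
  \int[lebesgue_measure]_(x in `]0, +oo[) (x `^ (alpha - 1) * expR (- x)).

Definition gamma_pdf alpha : R -> R :=
  (fun x => x `^ (alpha - 1) * expR (- x) / Gamma_fun alpha) \_ `]0, +oo[.

(* Gamma(alpha, 1); scale 1 and rate 1 coincide *)
Definition gamma_prob alpha (B : set R) : \bar R :=
  (\int[lebesgue_measure]_(x in B) (gamma_pdf alpha x)%:E)%E.

End gamma_distribution.

Definition mutually_independent (R : realType) d (Omega : measurableType d)
    (P : probability Omega R) (I : eqType) (X : I -> {RV P >-> R}) : Prop :=
  forall (s : seq I) (B : I -> set R), uniq s ->
    (forall i, measurable (B i)) ->
    P [set w | forall i, i \in s -> B i (X i w)] =
    (\prod_(i <- s) P (X i @^-1` B i))%E.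

(* Ulam-Harris words, read from the vertex up to the root: the root is [::] and
   the j-th child of u, for j = 1, 2, ..., is j :: u. *)
Definition vertex := seq nat.

Inductive label := Younger | Older.

(* As the older child, when there is one, is always the first child, the label
   of a vertex is a function of its word. *)
Fixpoint vlabel (u : vertex) : option label :=
  if u is j :: v then
    Some (match vlabel v with
          | Some Younger => Younger
          | _ => if j == 1%N then Older else Younger
          end)
  else None.

Definition has_older (u : vertex) : bool :=
  if vlabel u is Some Younger then false else true.

Definition older_child (u : vertex) : vertex := 1%N :: u.

(* k = 0, 1, ...; younger children are enumerated after the older one, if any *)
Definition younger_child (u : vertex) (k : nat) : vertex :=
  (has_older u + k).+1 :: u.

Section random_trees.
Context {R : realType} {d : measure_display} {Omega : measurableType d}.

(* The random variables attached to all words. The values of age and nyounger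
   at a word are irrelevant on the event that this word is not a vertex of the
   tree. *)
Record random_tree (P : probability Omega R) := RandomTree {
  age : vertex -> {RV P >-> R} ;
  nyounger : vertex -> {RV P >-> nat} ; (* number of younger children *)
  U_ : vertex -> {RV P >-> R} ;
  Gamma_ : vertex -> {RV P >-> R} }.

Context {P : probability Omega R}.
Implicit Types (T : random_tree P) (u : vertex) (w : Omega).

Definition degree T u w : nat := (has_older u + nyounger T u w)%N.

Fixpoint in_tree T u w : bool :=
  if u is j :: v then in_tree T v w && (0 < j <= degree T v w)%N else true.

(* counting measure of the ages of the younger children of u *)
Definition younger_count T u (B : set R) w : nat :=
  (\sum_(k < nyounger T u w) (age T (younger_child u k) w \in B))%N.

Definition gamma_shape (delta : R) u : R :=
  if vlabel u is Some Older then 2 + delta else 1 + delta.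

Definition intensity (delta : R) T u w (x : R) : R :=
  Gamma_ T u w / (2 + delta) *
  (x `^ (- ((1 + delta) / (2 + delta))) / age T u w `^ (2 + delta)^-1).

Definition mean_count (delta : R) T u (B : set R) w : R :=
  \int[lebesgue_measure]_(x in B `&` `[age T u w, 1]) intensity delta T u w x.

Definition noise T (i : option (vertex + vertex)) : {RV P >-> R} :=
  match i with
  | None => age T [::]
  | Some (inl u) => U_ T u
  | Some (inr u) => Gamma_ T u
  end.

(* sigma-algebra of all variables U_u, Gamma_u and of the tree with its ages
   up to generation n *)
Definition history T (n : nat) : set (set Omega) :=
  <<s [set E | (exists i B, measurable B /\ E = noise T i @^-1` B) \/
               (exists u B, [/\ (size u <= n)%N, measurable B &
                  E = [set w | in_tree T u w /\ B (age T u w)]])] >>.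

(* Conditionally on history T n, the point processes of the ages of the younger
   children of the vertices of generation n are independent Poisson processes
   with means mean_count: the numbers of points in finitely many sets are
   independent Poisson variables as soon as sets attached to the same vertex
   are disjoint. poisson_prob does not depend on its second argument; unlike
   poisson_pmf, it is the Dirac mass at 0 for rate 0. *)
Definition poisson_offspring (delta : R) T : Prop :=
  forall (n m : nat) (u : 'I_m -> vertex) (B : 'I_m -> set R) (k : 'I_m -> nat)
         (E : set Omega),
    (forall i, size (u i) = n) ->
    (forall i, measurable (B i)) ->
    (forall i j, i != j -> u i = u j -> B i `&` B j = set0) ->
    history T n E ->
    (forall w, E w -> forall i, in_tree T (u i) w) ->
    P (E `&` [set w | forall i, younger_count T (u i) (B i) w = k i]) =
    (\int[P]_(w in E)
       \prod_(i < m)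
         poisson_prob (mean_count delta T (u i) (B i) w) 0 [set k i])%E.

Record is_polya_point_tree (delta : R) T : Prop := IsPolyaPointTree {
  noise_independent : mutually_independent (noise T) ;
  root_age_uniform : forall B : set R, measurable B ->
    P (age T [::] @^-1` B) = uniform_prob (@ltr01 R) B ;
  U_uniform : forall u (B : set R), measurable B ->
    P (U_ T u @^-1` B) = uniform_prob (@ltr01 R) B ;
  Gamma_law : forall u (B : set R), measurable B ->
    P (Gamma_ T u @^-1` B) = gamma_prob (gamma_shape delta u) B ;
  older_child_age : forall u w, has_older u ->
    age T (older_child u) w =
    U_ T (older_child u) w `^ ((2 + delta) / (1 + delta)) * age T u w ;
  younger_children_ordered : forall u w k l, in_tree T u w ->
    (k <= l < nyounger T u w)%N ->
    age T (younger_child u k) w <= age T (younger_child u l) w ;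
  younger_children_poisson : poisson_offspring delta T }.

Definition friendship_bias T w : R :=
  (\sum_(1 <= j < (degree T [::] w).+1) (degree T [:: j] w + 1))%:R
    / (degree T [::] w)%:R
  - (degree T [::] w)%:R.

Lemma measurable_degree T u : measurable_fun [set: Omega] (degree T u).
Proof.
exact: (@measurableT_comp _ _ _ _ _ _ (fun n => has_older u + n)%N).
Qed.

Lemma measurable_friendship_bias T :
  measurable_fun [set: Omega] (friendship_bias T).
Proof.
pose F n w : R := (\sum_(1 <= j < n.+1) (degree T [:: j] w + 1))%:R / n%:R - n%:R.
have mF n : measurable_fun [set: Omega] (F n).
  apply: measurable_funB => //; apply: measurable_funM => //.
  rewrite [X in measurable_fun _ X](_ : _ = (fun w =>
     \sum_(1 <= j < n.+1) ((degree T [:: j] w)%:R + 1))); last first.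
    by apply/funext => w; rewrite natr_sum; under eq_bigr do rewrite natrD.
  apply: measurable_sum => j; apply: measurable_funD => //.
  by apply: (@measurableT_comp _ _ _ _ _ _ (fun k => k%:R : R)) => //;
    exact: measurable_degree.
move=> _ B mB; rewrite setTI.
rewrite (_ : _ @^-1` B =
  \bigcup_n (degree T [::] @^-1` [set n] `&` F n @^-1` B)).
  apply: bigcup_measurable => n _; apply: measurableI.
    by rewrite -[X in measurable X]setTI; exact: measurable_degree.
  by rewrite -[X in measurable X]setTI; exact: mF.
apply/seteqP; split=> [w Bw|w [n _ [/= <-]]] //.
by exists (degree T [::] w).
Qed.

HB.instance Definition _ T := isMeasurableFun.Build _ _ Omega R
  (friendship_bias T) (measurable_friendship_bias T).

End random_trees.

Definition is_friendship_bias_law (R : realType) (delta : R)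
    (mu : probability R R) : Prop :=
  exists (d : measure_display) (Omega : measurableType d)
         (P : probability Omega R) (T : random_tree P),
    is_polya_point_tree delta T /\
    forall B : set R, measurable B ->
      mu B = distribution P (friendship_bias T) B.

(* Main.v *)
(* If the root has no younger child, its only neighbour is its older child and
   the friendship bias is d_1 >= 0, so it suffices to bound from below the
   probability of this event. Given the age a and the Gamma variable g of the
   root, the number of younger children is Poisson with parameter
   g (a^(-1/(2+delta)) - 1). Integrating exp (- g (a^(-1/(2+delta)) - 1))
   against the law of g, which is Gamma(1+delta, 1), gives
   a^((1+delta)/(2+delta)), and integrating over the uniform age gives
   (2+delta)/(3+2 delta). This exceeds 1/2 and tends to 1 as delta decreases
   to -1. *)
Require Import Defs.
From HB Require Import structures.
From mathcomp Require Import all_boot all_order all_algebra.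
From mathcomp Require Import all_classical all_reals all_analysis.
From mathcomp Require Import measurable_realfun.
From mathcomp Require Import ring lra.
Import Order.TTheory GRing.Theory Num.Theory.
Import numFieldNormedType.Exports.
Local Open Scope classical_set_scope.
Local Open Scope ring_scope.

(** * Powers and linear substitution under Lebesgue measure *)

Lemma powR_derivable_oo_LRcontinuous (R : realType) (r a b : R) :
  0 <= a -> a < b -> 0 < a \/ 0 < r ->
  derivable_oo_LRcontinuous (fun x => x `^ r) a b.
Proof.
move=> a0 ab ar.
have dpow (x : R) : 0 < x -> derivable (fun y : R => y `^ r) x 1.
  by move=> x0; apply: derivable_powR; rewrite in_itv/= x0.
have cpow (x : R) : 0 < x -> {for x, continuous (fun y : R => y `^ r)}.
  by move=> x0; apply: differentiable_continuous; exact/derivable1_diffP/dpow.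
split => [x| |].
- by rewrite in_itv/= => /andP[ax _]; apply: dpow; exact: le_lt_trans ax.
- have [a0'|a0'] := ltP 0 a; first exact/cvg_at_right_filter/cpow.
  (* With left endpoint 0, only r > 0 remains, and x^r tends to 0 from the right, which is the value
     at 0. *)
  have {a0 a0'}a_eq0 : a = 0 by apply/eqP; rewrite eq_le a0 a0'.
  case: ar => [|r0]; first by rewrite a_eq0 ltxx.
  by rewrite a_eq0 powR0 ?gt_eqF//; exact: powR_cvg0.
- by apply/cvg_at_left_filter/cpow; exact: le_lt_trans ab.
Qed.

(** Fundamental theorem of calculus with primitive x^r / r. The last hypothesis keeps the integrand
    continuous up to [a]; both alternatives occur below, a positive age in [mean_count_root] and a =
    0 in [integral_root_void]. *)
Lemma integral_powR (R : realType) (r a b : R) :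
  0 <= a -> a < b -> 0 < r -> 0 < a \/ 1 < r ->
  (\int[lebesgue_measure]_(x in `[a, b]) (x `^ (r - 1))%:E =
   ((b `^ r - a `^ r) / r)%:E)%E.
Proof.
move=> a0 ab r0 ar.
have h0 : 0 < a \/ 0 < r by right.
have h1 : 0 < a \/ 0 < r - 1 by rewrite subr_gt0.
have [dF aF bF] := powR_derivable_oo_LRcontinuous R r a b a0 ab h0.
rewrite (@continuous_FTC2 _ _ (fun x => r^-1 *: (x `^ r)))//.
- by rewrite -EFinB /GRing.scale/= -mulrBr mulrC.
- apply: derivable_oo_LRcontinuous_within.
  exact: powR_derivable_oo_LRcontinuous.
- split.
  + by move=> x /dF ?; exact: derivableZ.
  + exact: cvgZl_tmp.
  + exact: cvgZl_tmp.
- move=> x xab; have x0 : 0 < x.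
    by move: xab; rewrite in_itv/= => /andP[ax _]; exact: le_lt_trans ax.
  rewrite derive1E deriveZ; last exact: dF.
  rewrite -derive1E powR_derive1 ?in_itv/= ?x0//.
  by rewrite /GRing.scale/= mulKf// gt_eqF.
Qed.

(** The image of Lebesgue measure under x -> c x, multiplied by c, agrees with Lebesgue measure on
    half-open intervals and hence equals it. *)
Lemma ge0_integral_scale (R : realType) (c : R) (f : R -> \bar R) :
  0 < c -> measurable_fun setT f -> (forall x, 0 <= f x)%E ->
  (\int[lebesgue_measure]_x f x =
   c%:E * \int[lebesgue_measure]_x f (c * x)%R)%E.
Proof.
move=> c0 mf f0.
pose phi (x : measurableTypeR R) : measurableTypeR R := c * x.
have mphi : measurable_fun [set: measurableTypeR R] phi.
  exact: mulrl_measurable.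
have preim (a b : R) : phi @^-1` `]a, b]%classic = `]a / c, b / c]%classic.
  apply/seteqP; split=> x /=; rewrite !in_itv/= /phi ltr_pdivrMr//;
    by rewrite ler_pdivlMr// mulrC.
pose k : {nonneg R} := NngNum (ltW c0).
have lnu (A : set R) : measurable A ->
    mscale k (pushforward (@lebesgue_measure R) phi) A = lebesgue_measure A.
  move=> mA; apply/esym/lebesgue_measure_unique => //= _ [[a b]] _ <-.
  rewrite /mscale/= /pushforward preim !lebesgue_measure_itv/= !lte_fin.
  rewrite ltr_pM2r ?invr_gt0//; case: ifPn => _; last by rewrite mule0.
  by rewrite -EFinB -EFinM -mulrBl mulrCA divff ?mulr1 ?gt_eqF.
rewrite [X in (_ * X)%E](_ : _ =
  (\int[lebesgue_measure]_(x in phi @^-1` setT) (f \o phi) x)%E)//.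
rewrite -(ge0_integral_pushforward mphi)//.
rewrite -[c]/(k%:num) -ge0_integral_mscale//.
by apply: eq_measure_integral => A mA _; apply/esym; apply: lnu.
Qed.

(** * Integration against a measure with a Lebesgue density *)

Section integral_density.
Local Open Scope ereal_scope.
Context (R : realType).
Local Notation mu := (@lebesgue_measure R).
Variables (nu : {measure set R -> \bar R}) (p : R -> R).
Hypotheses (mp : measurable_fun setT p) (p0 : forall x, (0 <= p x)%R).
Hypothesis nuE : forall B, measurable B -> nu B = \int[mu]_(x in B) (p x)%:E.

Import HBNNSimple.

(** For indicators this is [nuE]; linearity extends it to simple functions, and monotone convergence
    on both sides to [f]. *)
Lemma ge0_integral_lebesgue_density (f : R -> \bar R) :
  measurable_fun setT f -> (forall x, 0 <= f x) ->
  \int[nu]_x f x = \int[mu]_x (f x * (p x)%:E).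
Proof.
move=> mf f0; pose f_ := nnsfun_approx measurableT mf.
have mE (n : nat) : measurable_fun setT (fun x => (f_ n x)%:E).
  exact/measurable_EFinP.
have mEp (n : nat) : measurable_fun setT (fun x => (f_ n x)%:E * (p x)%:E).
  by apply: emeasurable_funM => //; exact/measurable_EFinP.
have f_0 (n : nat) x : 0 <= (f_ n x)%:E by rewrite lee_fin.
have nd x : {homo (fun n => (f_ n x)%:E) : m n / (m <= n)%N >-> m <= n}.
  by move=> m n mn; rewrite lee_fin; exact/lefP/nd_nnsfun_approx.
have flim x : (fun n => (f_ n x)%:E) @ \oo --> f x.
  exact: cvg_nnsfun_approx.
transitivity (limn (fun n => \int[nu]_x (f_ n x)%:E)).
  rewrite -monotone_convergence//.
  by apply: eq_integral => x _; apply/esym/cvg_lim.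
transitivity (limn (fun n => \int[mu]_x ((f_ n x)%:E * (p x)%:E))); last first.
  rewrite -monotone_convergence//; last 2 first.
  - by move=> n x _; rewrite mule_ge0// lee_fin.
  - by move=> x _ m n mn; rewrite lee_wpmul2r ?lee_fin// ?nd// -lee_fin nd.
  apply: eq_integral => x _; apply/cvg_lim => //.
  by apply: cvgeZr => //; exact: flim.
congr (limn _); apply/funext => n.
have mfr (r : R) : measurable_fun setT
    (fun x => (r * \1_(f_ n @^-1` [set r]) x)%:E).
  exact/measurable_EFinP/measurableT_comp.
under eq_integral do rewrite fimfunE -fsumEFin//.
rewrite ge0_integral_fsum//; last first.
  by move=> r x _; rewrite EFinM nnfun_muleindic_ge0.
under [RHS]eq_integral.
  move=> x _; rewrite fimfunE -fsumEFin// ge0_mule_fsuml; last first.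
    by move=> r; rewrite EFinM nnfun_muleindic_ge0.
  over.
rewrite ge0_integral_fsum//; last 2 first.
  - move=> r; apply: emeasurable_funM; last exact/measurable_EFinP.
    exact: mfr.
  - move=> r x _; apply: mule_ge0; last by rewrite lee_fin.
    by rewrite EFinM nnfun_muleindic_ge0.
apply: eq_fsbigr => r _.
have mr : measurable (f_ n @^-1` [set r]) by exact: measurable_funPTI.
rewrite integralZl_indic_nnsfun//= integral_indic// setIT nuE//.
(* Level sets of negative [r] are empty because [f_ n] is nonnegative; for the others the constant
   can be pulled out. *)
have [r0|r0] := leP 0%R r; last first.
  rewrite preimage_nnfun0// integral_set0 mule0.
  by apply/esym/integral0_eq => x _; rewrite indic0 mulr0 mul0e.
under [RHS]eq_integral do rewrite EFinM -muleA.
rewrite ge0_integralZl//; last 2 first.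
- by apply: emeasurable_funM; exact/measurable_EFinP.
- by move=> x _; rewrite mule_ge0// lee_fin.
congr (_ * _); rewrite [LHS]integral_mkcond.
apply: eq_integral => x _.
by rewrite patchE indicE; case: ifPn => _; rewrite ?mul1e ?mul0e.
Qed.

End integral_density.

(** * The Gamma density and its Laplace transform *)

Section gamma_pdf.
Context {R : realType}.
Implicit Types alpha c x : R.

Lemma gamma_pdf_ge0 alpha x : 0 <= gamma_pdf alpha x.
Proof.
rewrite /gamma_pdf patchE; case: ifPn => // _.
apply: divr_ge0; first by rewrite mulr_ge0 ?powR_ge0 ?expR_ge0.
by apply: Rintegral_ge0 => y _; rewrite mulr_ge0 ?powR_ge0 ?expR_ge0.
Qed.

Lemma measurable_gamma_pdf alpha : measurable_fun setT (gamma_pdf alpha).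
Proof.
apply/(measurable_restrictT _ _).1 => //; apply: measurable_funTS.
apply: measurable_funM => //; apply: measurable_funM.
  exact: measurable_powR.
by apply: measurableT_comp => //; exact: measurable_oppr.
Qed.

(** Tilting by the exponential changes the rate from 1 to c, and x^(alpha - 1) = c^(1 - alpha) (c
    x)^(alpha - 1) turns the result into the rate 1 density at c x. *)
Lemma gamma_pdf_scale alpha c x : 0 < c ->
  expR (- (x * (c - 1))) * gamma_pdf alpha x =
  c `^ (1 - alpha) * gamma_pdf alpha (c * x).
Proof.
move=> c0; rewrite /gamma_pdf !patchE.
have -> : (c * x \in `]0, +oo[%classic) = (x \in `]0, +oo[%classic).
  by apply/idP/idP; rewrite !inE/= !in_itv/= !andbT pmulr_rgt0.
case: ifPn; rewrite ?mulr0// inE/= in_itv/= andbT => x0.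
have cc : c `^ (1 - alpha) * c `^ (alpha - 1) = 1.
  rewrite -powRD; last by apply/implyP => _; rewrite gt_eqF.
  by rewrite addrC addrA subrK subrr powRr0.
have -> : expR (- (c * x)) = expR (- (x * (c - 1))) * expR (- x).
  by rewrite -expRD; congr expR; ring.
by rewrite powRM ?ltW// -[LHS]mul1r -[X in X * _ = _]cc; ring.
Qed.

(** Laplace transform at c - 1: after tilting, the substitution x -> c x leaves c^(1 - alpha) c^(-1)
    times the total mass. That this mass is 1 is a hypothesis; at the root it follows from
    [Gamma_law]. *)
Lemma integral_gamma_expR alpha c :
  0 < c -> gamma_prob alpha [set: R] = 1%E ->
  (\int[lebesgue_measure]_x
     ((expR (- (x * (c - 1))))%:E * (gamma_pdf alpha x)%:E) =
   (c `^ (- alpha))%:E)%E.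
Proof.
move=> c0 gamma1.
under eq_integral do rewrite -EFinM gamma_pdf_scale// EFinM.
have mpdf : measurable_fun setT (fun x => (gamma_pdf alpha x)%:E).
  by apply/measurable_EFinP; exact: measurable_gamma_pdf.
have mpdfc : measurable_fun setT (fun x => (gamma_pdf alpha (c * x))%:E).
  apply/measurable_EFinP; apply: measurableT_comp => //.
  exact: measurable_gamma_pdf.
rewrite ge0_integralZl//; last 2 first.
- by move=> x _; rewrite lee_fin gamma_pdf_ge0.
- by rewrite lee_fin powR_ge0.
have := gamma1; rewrite /gamma_prob (@ge0_integral_scale _ c)//; last first.
  by move=> x; rewrite lee_fin gamma_pdf_ge0.
set I := (\int[_]_x _)%E => cI1.
have -> : I = (c^-1)%:E.
  by rewrite -[I]mul1e -(@mulVf _ c) ?gt_eqF// EFinM -muleA cI1 mule1.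
rewrite -EFinM; congr EFin; rewrite -[c^-1]powR_inv1 ?ltW// -powRD.
  by congr (_ `^ _); ring.
by apply/implyP => _; rewrite gt_eqF.
Qed.

End gamma_pdf.

(** * Independent pairs and the variables generating the history *)

Lemma ge0_integral_independent_pair d (Omega : measurableType d)
    (R : realType) (P : probability Omega R) (X Y : {RV P >-> R})
    (f : R * R -> \bar R) :
  (forall A B, measurable A -> measurable B ->
     P (X @^-1` A `&` Y @^-1` B) = P (X @^-1` A) * P (Y @^-1` B))%E ->
  measurable_fun setT f -> (forall z, 0 <= f z)%E ->
  (\int[P]_w f (X w, Y w) =
   \int[distribution P X]_x \int[distribution P Y]_y f (x, y))%E.
Proof.
move=> XY mf f0.
pose phi w := (X w, Y w).
have mphi : measurable_fun setT phi by exact: measurable_fun_pair.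
rewrite -(@fubini_tonelli1 _ _ _ _ _ (distribution P X) (distribution P Y))//.
rewrite [LHS](_ : _ = (\int[P]_(x in phi @^-1` setT) (f \o phi) x)%E)//.
rewrite -(ge0_integral_pushforward mphi)//.
(* Independence makes the joint law agree with the product of the marginals on rectangles, hence
   everywhere. *)
apply: eq_measure_integral => A mA _; apply/esym.
by apply: product_measure_unique => // B C mB mC; exact: XY.
Qed.

Lemma history_noise d (Omega : measurableType d) (R : realType)
    (P : probability Omega R) (T : random_tree P) n i (B : set R) :
  measurable B -> history T n (noise T i @^-1` B).
Proof. by move=> mB; apply: sub_sigma_algebra; left; exists i, B. Qed.

(** * The root: probability of no younger child, and friendship bias *)

Section root.
Context d (Omega : measurableType d) (R : realType) (P : probability Omega R).
Variables (T : random_tree P) (delta : R).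
Hypotheses (delta_gtN1 : -1 < delta) (T_polya : is_polya_point_tree delta T).

Let A := age T [::].
Let G := Gamma_ T [::].

Let delta1_gt0 : 0 < 1 + delta. Proof. by move: delta_gtN1; lra. Qed.
Let delta2_gt0 : 0 < 2 + delta. Proof. by move: delta_gtN1; lra. Qed.
Let q : R := (2 + delta)^-1.
Let q_gt0 : 0 < q. Proof. by rewrite invr_gt0. Qed.

Lemma root_age_Gamma_independent (B C : set R) :
  measurable B -> measurable C ->
  P (A @^-1` B `&` G @^-1` C) = (P (A @^-1` B) * P (G @^-1` C))%E.
Proof.
move=> mB mC.
(* In [noise], [None] indexes the age of the root and [Some (inr [::])] its Gamma variable. *)
pose s : seq (option (vertex + vertex)) := [:: None; Some (inr [::])].
pose D (i : option (vertex + vertex)) : set R := if i is None then B else C.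
have mD i : measurable (D i) by case: i.
have := noise_independent T_polya (isT : uniq s) mD.
rewrite /s !big_cons big_nil mule1 /= => <-; congr (P _).
apply/seteqP; split=> [w [Bw Cw] i|w sw].
  by rewrite !inE => /orP[] /eqP ->.
by split; [have := sw None|have := sw (Some (inr [::]))]; apply; rewrite !inE.
Qed.

(** For age a and Gamma variable g, the intensity is g q a^(-q) x^(q - 1), and x^(q - 1) integrates
    to (1 - a^q) / q over [a, 1]. *)
Lemma mean_count_root w : 0 < A w -> A w < 1 ->
  mean_count delta T [::] setT w = G w * (A w `^ (- q) - 1).
Proof.
move=> A0 A1; rewrite /mean_count setTI /Rintegral.
rewrite (eq_integral (fun x : measurableTypeR R =>
   (G w * q * A w `^ (- q))%:E * (x `^ (q - 1))%:E)%E); last first.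
  move=> x _; rewrite -EFinM /intensity -/A -/G; congr EFin.
  have -> : - ((1 + delta) / (2 + delta)) = q - 1.
    by rewrite /q; field; rewrite gt_eqF.
  by rewrite powRN -/q; ring.
rewrite integralZl//; last first.
  apply: continuous_compact_integrable; first exact: segment_compact.
  apply: derivable_oo_LRcontinuous_within.
  by apply: powR_derivable_oo_LRcontinuous => //; [exact: ltW|left].
rewrite integral_powR//; [|exact: ltW|by left].
rewrite -EFinM/= powR1 powRN; field.
by rewrite !gt_eqF ?powR_gt0.
Qed.

(* This almost sure event excludes the age 0, at which the formula of
   mean_count_root fails because 0 `^ (- q) = 0. *)
Lemma history_root_event : history T 0 (A @^-1` `]0, 1[ `&` G @^-1` `]0, +oo[).
Proof.
pose Gen := [set E | (exists i B, measurable B /\ E = noise T i @^-1` B) \/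
               (exists u B, [/\ (size u <= 0)%N, measurable B &
                  E = [set w | in_tree T u w /\ B (age T u w)]])].
apply: (@measurableI _ (g_sigma_algebraType Gen)).
  exact: (@history_noise _ _ _ _ T 0 None).
exact: (@history_noise _ _ _ _ T 0 (Some (inr [::]))).
Qed.

(** Makes the complement negligible, so that the Poisson formula, applied on this event, can be
    compared with an integral over the whole space. *)
Lemma root_event_prob1 : P (A @^-1` `]0, 1[ `&` G @^-1` `]0, +oo[) = 1%E.
Proof.
rewrite root_age_Gamma_independent// (root_age_uniform T_polya)//.
rewrite (Gamma_law T_polya)//.
have -> : uniform_prob (@ltr01 R) `]0, 1[ = 1%E.
  rewrite /uniform_prob -(@integral_itv_bndoo _ 0 1 _ true false); last first.
    apply/measurable_EFinP; apply: measurable_funTS.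
    exact: measurable_uniform_pdf.
  exact: integral_uniform_pdf1.
(* The Gamma density has total mass 1, being that of a random variable, and vanishes off the
   positive half-line. *)
have := Gamma_law T_polya [::] measurableT.
rewrite preimage_setT probability_setT => G1.
rewrite mul1e [RHS]G1 /gamma_prob [RHS](_ : _ = \int[lebesgue_measure]_x
   ((EFin \o gamma_pdf (gamma_shape delta [::])) \_ `]0%R, +oo[) x)%E.
  by rewrite integral_mkcond.
apply: eq_integral => x _; rewrite patchE /gamma_pdf /= patchE.
by case: ifPn.
Qed.

Lemma integral_root_void :
  (\int[P]_w (expR (- (G w * (A w `^ (- q) - 1))))%:E =
   ((2 + delta) / (3 + 2 * delta))%:E)%E.
Proof.
pose f (z : R * R) : \bar R := (expR (- (z.2 * (z.1 `^ (- q) - 1))))%:E.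
have mf : measurable_fun setT f.
  apply/measurable_EFinP; apply: measurableT_comp => //.
  apply: measurableT_comp => //; apply: measurable_funM => //.
  apply: measurable_funB => //.
  by apply: (@measurableT_comp _ _ _ _ _ _ (@powR R ^~ (- q))).
have f0 z : (0 <= f z)%E by rewrite lee_fin expR_ge0.
rewrite [LHS](@ge0_integral_independent_pair _ _ _ P A G f)//; last first.
  exact: root_age_Gamma_independent.
have shape : gamma_shape delta [::] = 1 + delta by [].
have Gtotal : gamma_prob (1 + delta) [set: R] = 1%E.
  by rewrite -shape -(Gamma_law T_polya)// preimage_setT probability_setT.
(* Laplace transform with c = x^(-q). The exponent keeps the form r - 1 expected by
   [integral_powR]. *)
have inner x : 0 < x ->
    (\int[distribution P G]_y f (x, y) =
     (x `^ ((1 + delta) / (2 + delta) + 1 - 1))%:E)%E.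
  move=> x0.
  rewrite (@ge0_integral_lebesgue_density _ _ (gamma_pdf (1 + delta)))//.
  - rewrite (integral_gamma_expR _ (x `^ (- q)) (powR_gt0 _ x0) Gtotal).
    by rewrite -powRrM; congr (_ `^ _)%:E; rewrite /q; field; rewrite gt_eqF.
  - exact: measurable_gamma_pdf.
  - exact: gamma_pdf_ge0.
  - by move=> B mB; rewrite -/(gamma_prob _ _) -shape -(Gamma_law T_polya).
  - exact: measurableT_comp.
have mF : measurable_fun setT (fun x => \int[distribution P G]_y f (x, y))%E.
  exact: measurable_fun_fubini_tonelli_F.
rewrite (@ge0_integral_lebesgue_density _ _ (uniform_pdf 0 1))//; last 4 first.
- exact: measurable_uniform_pdf.
- by move=> x; apply: uniform_pdf_ge0.
- by move=> B mB; exact: (root_age_uniform T_polya).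
- by move=> x; exact: integral_ge0.
transitivity (\int[lebesgue_measure]_(x in `[0%R, 1%R])
    \int[distribution P G]_y f (x, y))%E.
  rewrite [RHS]integral_mkcond; apply: eq_integral => x _.
  rewrite patchE /uniform_pdf mem_setE in_itv/= subr0 invr1.
  by case: ifPn => _; rewrite ?mule1 ?mule0.
(* The endpoint 0, where [inner] does not apply, is removed here and restored once the integrand is
   a power. *)
rewrite -integral_itv_obnd_cbnd; last exact: measurable_funTS.
rewrite (eq_integral (fun x : measurableTypeR R =>
    (x `^ ((1 + delta) / (2 + delta) + 1 - 1))%:E)); last first.
  by move=> x; rewrite inE/= in_itv/= => /andP[x0 _]; exact: inner.
have p0 : 0 < (1 + delta) / (2 + delta) by rewrite divr_gt0.
rewrite integral_itv_obnd_cbnd; last first.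
  by apply/measurable_EFinP; apply: measurable_funTS; exact: measurable_powR.
rewrite integral_powR//; last 2 first.
- by rewrite addr_gt0.
- by right; rewrite ltrDr.
rewrite powR1 powR0 ?gt_eqF ?addr_gt0// subr0; congr EFin.
have delta3_gt0 : 0 < 3 + 2 * delta by move: delta_gtN1; lra.
by field; rewrite !gt_eqF.
Qed.

Lemma nyounger_root_eq0_prob :
  (((2 + delta) / (3 + 2 * delta))%:E <= P (nyounger T [::] @^-1` [set 0%N]))%E.
Proof.
pose E := A @^-1` `]0, 1[ `&` G @^-1` `]0, +oo[.
have mE : measurable E.
  by apply: measurableI; exact: measurable_funPTI.
have void : [set w | forall i : 'I_1, younger_count T [::] setT w = 0%N] =
    nyounger T [::] @^-1` [set 0%N].
  have countT w : younger_count T [::] setT w = nyounger T [::] w.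
    rewrite /younger_count; under eq_bigr do rewrite in_setT.
    by rewrite sum1_card card_ord.
  by apply/seteqP; split=> [w /(_ ord0)|w /= Nw i]; rewrite countT.
have disj (i j : 'I_1) : i != j -> [::] = [::] :> vertex ->
    [set: R] `&` setT = set0 by rewrite !ord1.
(* A single test: the root, the whole line and the count 0, on an event of generation 0. *)
have PE := @younger_children_poisson _ _ _ _ _ _ T_polya 0%N 1%N (fun=> [::])
  (fun=> setT) (fun=> 0%N) E (fun=> erefl) (fun=> measurableT) disj
  history_root_event (fun _ _ _ => isT).
rewrite -/E void in PE.
apply: (@le_trans _ _ (P (E `&` nyounger T [::] @^-1` [set 0%N]))); last first.
  have mN : measurable (nyounger T [::] @^-1` [set 0%N]).
    exact: measurable_funPTI.
  by apply: le_measure; rewrite ?inE//; exact: measurableI.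
rewrite PE -integral_root_void.
rewrite (@ge0_negligible_integral _ _ _ _ _ (~` E))//; last 3 first.
- exact: measurableC.
- apply/measurable_EFinP; apply: measurableT_comp => //.
  apply: measurableT_comp => //; apply: measurable_funM => //.
  apply: measurable_funB => //.
  by apply: (@measurableT_comp _ _ _ _ _ _ (@powR R ^~ (- q))).
- have PEC := probability_setC P mE.
  by rewrite (root_event_prob1 : P E = 1%E) subee// in PEC.
rewrite setTD setCK le_eqVlt; apply/orP; left; apply/eqP.
apply: eq_integral => w.
rewrite inE => -[/=]; rewrite !in_itv/= andbT => /andP[A0 A1] G0.
rewrite big_ord1 mean_count_root// /poisson_prob.
(* For a positive rate, [poisson_prob] is given by [poisson_pmf], whose value at 0 is the
   exponential of minus the rate. *)
have r0 : 0 < G w * (A w `^ (- q) - 1).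
  rewrite mulr_gt0// subr_gt0 powRN invf_gt1 ?powR_gt0//.
  rewrite -[X in _ < X](_ : 1 `^ q = 1); last by rewrite powR1.
  by rewrite gt0_ltr_powR// nnegrE ltW.
rewrite r0 esum_set1 ?lee_fin ?poisson_pmf_ge0// /poisson_pmf r0.
by rewrite expr0 fact0 invr1 !mul1r.
Qed.

Lemma friendship_bias_ge0 w : nyounger T [::] w = 0%N ->
  0 <= friendship_bias T w.
Proof.
move=> N0; have deg1 : degree T [::] w = 1%N by rewrite /degree N0.
by rewrite /friendship_bias deg1 big_nat1 divr1 natrD addrK.
Qed.

Lemma friendship_bias_nonneg_prob :
  (((2 + delta) / (3 + 2 * delta))%:E <=
   distribution P (friendship_bias T) `[0%R, +oo[)%E.
Proof.
apply: (le_trans nyounger_root_eq0_prob); apply: le_measure.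
- by rewrite inE -[X in measurable X]setTI; exact: measurable_funP.
- by rewrite inE -[X in measurable X]setTI; exact: measurable_funP.
- by move=> w /= N0; rewrite in_itv/= andbT friendship_bias_ge0.
Qed.

End root.

(** * Lower bound and limit for the law of the friendship bias *)

Theorem theorem4p12 (R : realType) (mu : R -> probability R R)
    (hmu : forall delta : R, -1 < delta ->
       is_friendship_bias_law delta (mu delta)) :
  (forall delta : R, -1 < delta ->
     ((2^-1)%:E < mu delta `[0%R, +oo[%classic)%E) /\
  mu delta `[0, +oo[%classic @[delta --> (-1 : R)^'+] --> 1%:E.
Proof.
have lower (delta : R) : -1 < delta ->
    (((2 + delta) / (3 + 2 * delta))%:E <= mu delta `[0%R, +oo[%classic)%E.
  move=> dN1; have [d [Om [P [T [T_polya muE]]]]] := hmu _ dN1.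
  rewrite muE//; exact: friendship_bias_nonneg_prob.
split=> [delta delta_gtN1|].
  apply: lt_le_trans (lower _ delta_gtN1).
  have d3 : 0 < 3 + 2 * delta by move: delta_gtN1; lra.
  (* Clearing denominators leaves 3 + 2 delta < 4 + 2 delta. *)
  by rewrite lte_fin ltr_pdivlMr//; move: delta_gtN1; lra.
apply: (@squeeze_cvge _ _ _ _
  (fun delta : R => ((2 + delta) / (3 + 2 * delta))%:E) _ (fun=> 1%E)).
- by near=> delta; rewrite lower ?probability_le1.
- apply: cvg_EFin; first by near=> delta.
  (* The denominator equals 1 at delta = -1, so the bound is continuous there and the one-sided
     limit is its value. *)
  have lim : (2 + delta) / (3 + 2 * delta) @[delta --> (-1 : R)] -->
      ((2 + -1) / (3 + 2 * -1) : R).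
    apply: cvgM; first by apply: cvgD; [exact: cvg_cst|exact: cvg_id].
    apply: cvgV; first by apply/eqP; lra.
    apply: cvgD; first exact: cvg_cst.
    by apply: cvgM; [exact: cvg_cst|exact: cvg_id].
  have lim1 : (2 + -1) / (3 + 2 * -1) = 1 :> R by field.
  by rewrite lim1 in lim; exact: cvg_at_right_filter.
- exact: cvg_cst.
Unshelve. all: by end_near. Qed.
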